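(* Let $H$ be an infinite-dimensional complex Hilbert space. Then $$\|(x_1,\dots,x_n)\|_n^H=\|(x_1,\dots,x_n)\|_n^{(2,2)}\quad(x_1,\dots,x_n\in H)$$ for each $n\in\mathbb N$.
   Context: The Hilbert multi-norm: for $n\in\mathbb N$ and $x_1,\dots,x_n\in H$, $\|(x_1,\dots,x_n)\|_n^H=\sup\|P_1x_1+\cdots+P_nx_n\|=\sup(\|P_1x_1\|^2+\cdots+\|P_nx_n\|^2)^{1/2}$, where the supremum is over all families $\{H_1,\dots,H_n\}$ of pairwise orthogonal closed subspaces of $H$ (some possibly $\{0\}$) with $H=H_1\oplus\cdots\oplus H_n$, and $P_i$ is the orthogonal projection of $H$ onto $H_i$. The $(2,2)$-multi-norm based on $H$: $\|(x_1,\dots,x_n)\|_n^{(2,2)}=\sup\{(\sum_{i=1}^n|\langle x_i,\lambda_i\rangle|^2)^{1/2}:\lambda_1,\dots,\lambda_n\in H',\ \mu_{2,n}(\lambda_1,\dots,\lambda_n)\le1\}$, where $H'$ is the dual space and $\mu_{2,n}(\lambda_1,\dots,\lambda_n)=\sup\{(\sum_{j=1}^n|\langle x,\lambda_j\rangle|^2)^{1/2}:x\in H,\|x\|\le1\}$. *)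

(* Defs.v *)
From HB Require Import structures.
From mathcomp Require Import all_boot all_order all_algebra.
From mathcomp Require Import sesquilinear.
From mathcomp Require Import complex.
From mathcomp Require Import all_classical all_reals all_analysis.

Set Implicit Arguments.
Unset Strict Implicit.
Unset Printing Implicit Defensive.

Import Order.TTheory GRing.Theory Num.Theory.
Import numFieldNormedType.Exports.

Local Open Scope classical_set_scope.
Local Open Scope complex_scope.
Local Open Scope ring_scope.

Section MultiNorms.
Variable R : realType.

(* The norm of a complex normed space takes values in R[i], where it is a
   nonnegative real; rnorm x is the same number in R. *)
Definition rnorm (V : normedZmodType R[i]) (x : V) : R := complex.Re `|x|.

Variable H : completeNormedModType R[i].

(* A completeNormedModType R[i] satisfying this for some form is a complex
   Hilbert space; the form is linear in its first variable. *)
Definition is_hilbert_inner (dot : {dot H for Num.conj}) : Prop :=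
  forall x : H, `|x| ^+ 2 = dot x x.

Definition finite_dimensional : Prop :=
  exists (m : nat) (b : 'I_m -> H),
    forall x : H, exists c : 'I_m -> R[i], x = \sum_i c i *: b i.

Definition closed_subspace (S : set H) : Prop :=
  submod_closed [in S] /\ closed S.

Definition direct_sum_decomposition n (Hs : 'I_n -> set H) : Prop :=
  forall x : H, exists! y : 'I_n -> H,
    (forall i, Hs i (y i)) /\ x = \sum_i y i.

Section Hilbert.
Variable dot : {dot H for Num.conj}.

Definition orthogonal_decomposition n (Hs : 'I_n -> set H) : Prop :=
  [/\ forall i, closed_subspace (Hs i),
      forall i j, i != j -> forall x y, Hs i x -> Hs j y -> dot x y = 0
    & direct_sum_decomposition Hs].

Definition is_orthogonal_projection (S : set H) (P : H -> H) : Prop :=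
  forall x, S (P x) /\ forall y, S y -> dot (x - P x) y = 0.

(* Suprema are taken in the extended reals, so that no convention about
   suprema of unbounded sets of reals intervenes. *)
Definition hilbert_multinorm n (x : 'I_n -> H) : \bar R :=
  ereal_sup [set r : \bar R |
    exists (Hs : 'I_n -> set H) (P : 'I_n -> H -> H),
      [/\ orthogonal_decomposition Hs,
          forall i, is_orthogonal_projection (Hs i) (P i)
        & r = (rnorm (\sum_i P i (x i)))%:E]].

End Hilbert.

Record dual := Dual {
  dual_fun :> {linear H -> R[i]^o};
  dual_continuous : continuous dual_fun
}.

Definition weak_2_summing_norm n (lam : 'I_n -> dual) : \bar R :=
  ereal_sup [set (Num.sqrt (\sum_j rnorm (lam j x) ^+ 2))%:E
            | x in [set x : H | rnorm x <= 1]].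

Definition multinorm22 n (x : 'I_n -> H) : \bar R :=
  ereal_sup [set (Num.sqrt (\sum_i rnorm (lam i (x i)) ^+ 2))%:E
            | lam in [set lam : 'I_n -> dual |
                       (weak_2_summing_norm lam <= 1)%E]].

End MultiNorms.

(* Main.v *)
(* If P_1, ..., P_n are the projections of an orthogonal decomposition, the
   vectors y_i = P_i x_i are orthogonal, and the functionals <., y_i/|y_i|> are
   admissible by Bessel's inequality; this gives one inequality.
   Conversely let lam be admissible and let e_1, ..., e_m be orthonormal with
   span containing the x_i.  The matrix L = (lam_i(e_k)) is a contraction, so
   I - L L^* = A A^* for some A.  As H is infinite-dimensional, there are
   orthonormal f_1, ..., f_n orthogonal to the e_k, and the rows of (L | A),
   read as (conjugate) coordinates with respect to e and f, are orthonormal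
   vectors w_i with <x_i, w_i> = lam_i(x_i).  Any orthogonal decomposition with
   w_i in the i-th summand does at least as well as lam. *)
Require Import Defs.
From HB Require Import structures.
From mathcomp Require Import all_boot all_order all_algebra.
From mathcomp Require Import sesquilinear spectral.
From mathcomp Require Import complex.
From mathcomp Require Import all_classical all_reals all_analysis.
Import Order.TTheory GRing.Theory Num.Theory.
Import numFieldNormedType.Exports.
Local Open Scope complex_scope.
Local Open Scope ring_scope.

Set Implicit Arguments.
Unset Strict Implicit.

(** * Completing a contraction matrix to one with orthonormal rows *)

Section InnerProductSpaces.
Local Open Scope sesquilinear_scope.

(** [G = L L^*] is Hermitian, so the spectral theorem diagonalizes it unitarily. Contractivity puts
    its eigenvalues in [0, 1], hence [1 - G] has a square root, which serves as a factor [A]. *)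
Lemma contraction_complement (C : numClosedFieldType) n m (L : 'M[C]_(n, m)) :
  (forall y : 'cV[C]_m,
     \sum_i `|(L *m y) i 0| ^+ 2 <= \sum_k `|y k 0| ^+ 2) ->
  exists A : 'M[C]_n, L *m L^t* + A *m A^t* = 1%:M.
Proof.
move=> Lcontr; pose G := L *m L^t*.
have GH : G^t* = G by rewrite /G trmx_mul map_mxM trmxCK.
have /orthomx_spectralP : G \is normalmx by apply/normalmxP; rewrite GH.
rewrite invmx_unitary ?spectral_unitarymx //.
set P := spectralmx G; set d := spectral_diag G => defG.
have PPt : P *m P^t* = 1%:M by apply/unitarymxP/spectral_unitarymx.
have PtP : P^t* *m P = 1%:M by apply: mulmx1C.
have normE p (v : 'cV[C]_p) : (v^t* *m v) 0 0 = \sum_k `|v k 0| ^+ 2.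
  by rewrite mxE; apply: eq_bigr => k _; rewrite !mxE normCKC.
have PG : P *m G = diag_mx d *m P by rewrite defG !mulmxA PPt mul1mx.
have d_bounds i : 0 <= d 0 i <= 1.
  pose r := row i P.
  have rG : r *m G = d 0 i *: r.
    by rewrite /r -row_mul PG; apply/rowP => j; rewrite mul_diag_mx !mxE.
  have rr : (r *m r^t*) 0 0 = 1.
    have <- : (P *m P^t*) i i = 1 by rewrite PPt mxE eqxx.
    by rewrite !mxE; apply: eq_bigr => j _; rewrite !mxE.
  pose y := (r *m L)^t*.
  have y2 : (y^t* *m y) 0 0 = d 0 i.
    rewrite /y trmxCK trmx_mul map_mxM mulmxA -(mulmxA r) -/G rG.
    by rewrite -scalemxAl mxE rr mulr1.
  have Ly : L *m y = (d 0 i)^* *: r^t*.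
    have -> : L *m y = (r *m G)^t*.
      by rewrite trmx_mul map_mxM GH /y trmx_mul map_mxM mulmxA.
    by rewrite rG; apply/matrixP => a b; rewrite !mxE rmorphM.
  have d0 : 0 <= d 0 i.
    by rewrite -y2 normE; apply: sumr_ge0 => k _; rewrite exprn_ge0.
  rewrite d0 /=; have := Lcontr y; rewrite -!normE y2 Ly.
  have -> : (((d 0 i)^* *: r^t*)^t* *m ((d 0 i)^* *: r^t*)) 0 0 = d 0 i * d 0 i.
    have -> : ((d 0 i)^* *: r^t*)^t* = d 0 i *: r.
      by apply/matrixP => a b; rewrite !mxE rmorphM /= !conjCK.
    rewrite -scalemxAl -scalemxAr scalerA mxE rr mulr1.
    by rewrite (CrealP (ger0_real d0)).
  move: d0; rewrite le0r => /orP[/eqP-> _|d_gt0]; first exact: ler01.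
  by rewrite -{3}[d 0 i]mulr1 ler_pM2l.
exists (P^t* *m diag_mx (map_mx (fun z => sqrtC (1 - z)) d)).
rewrite -/G trmx_mul map_mxM trmxCK mulmxA -(mulmxA (P^t*)).
rewrite tr_diag_mx map_diag_mx mulmx_diag defG.
rewrite -mulmxDl -mulmxDr -PtP -[in RHS](mulmx1 (P^t*)).
congr (_ *m _ *m _); rewrite -diag_const_mx -raddfD /=; congr diag_mx.
apply/rowP => i; rewrite !mxE -normCK.
have /andP[d0 d1] := d_bounds i.
by rewrite ger0_norm ?sqrtC_ge0 ?subr_ge0 // sqrtCK addrC subrK.
Qed.

(** * Rules for the inner product and Bessel's inequality *)

Section DotProduct.
Variables (C : numClosedFieldType) (U : lmodType C).
Variable dot : {dot U for Num.conj}.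

Lemma dotZl a u v : dot (a *: u) v = a * dot u v.
Proof. exact: linearZl_LR. Qed.

Lemma dotZr a u v : dot u (a *: v) = a^* * dot u v.
Proof. exact: linearZr_LR. Qed.

Lemma dotDl u v w : dot (u + v) w = dot u w + dot v w.
Proof. exact: linearDl. Qed.

Lemma dotBl u v w : dot (u - v) w = dot u w - dot v w.
Proof. exact: linearBl. Qed.

Lemma dotDr u v w : dot u (v + w) = dot u v + dot u w.
Proof. exact: linearDr. Qed.

Lemma dotBr u v w : dot u (v - w) = dot u v - dot u w.
Proof. exact: linearBr. Qed.

Lemma dot0l v : dot 0 v = 0.
Proof. exact: linear0l. Qed.

Lemma dot0r u : dot u 0 = 0.
Proof. exact: linear0r. Qed.

Lemma dot_suml (I : Type) r (P : pred I) (F : I -> U) v :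
  dot (\sum_(i <- r | P i) F i) v = \sum_(i <- r | P i) dot (F i) v.
Proof. exact: linear_sumlz. Qed.

Lemma dot_sumr (I : Type) r (P : pred I) (F : I -> U) u :
  dot u (\sum_(i <- r | P i) F i) = \sum_(i <- r | P i) dot u (F i).
Proof. exact: linear_sumr. Qed.

Lemma dotC u v : dot u v = (dot v u)^*.
Proof. by rewrite hermC expr0 mul1r. Qed.

Lemma dnorm_sum (I : finType) (y : I -> U) :
  (forall i j, i != j -> dot (y i) (y j) = 0) ->
  dot (\sum_i y i) (\sum_i y i) = \sum_i dot (y i) (y i).
Proof.
move=> yo; rewrite dot_suml; apply: eq_bigr => i _.
rewrite dot_sumr (bigD1 i) //= big1 ?addr0 // => j ji.
by rewrite yo // eq_sym.
Qed.

(* The quotient is 0 at the indices where y i = 0. *)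
Lemma bessel (I : finType) (y : I -> U) z :
  (forall i j, i != j -> dot (y i) (y j) = 0) ->
  \sum_i `|dot z (y i)| ^+ 2 / dot (y i) (y i) <= dot z z.
Proof.
(* [p] is the orthogonal projection of [z] onto the span of the [y i]. The sum to be bounded is
   [dot p p], and Pythagoras for [z - p] and [p] concludes. *)
move=> yo; pose c i := dot z (y i) / dot (y i) (y i).
pose p := \sum_i c i *: y i.
have rp j : dot (z - p) (y j) = 0.
  rewrite dotBl dot_suml (bigD1 j) //= big1 => [|i ij].
    rewrite addr0 dotZl /c; have [->|yj] := eqVneq (y j) 0.
      by rewrite !dot0r mulr0 subrr.
    by rewrite divfK ?dnorm_eq0 // subrr.
  by rewrite dotZl yo // mulr0.
have dp : dot (z - p) p = 0.
  move: rp; move: (z - p) => r rp.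
  by rewrite /p dot_sumr big1 // => j _; rewrite dotZr rp mulr0.
have -> : dot z z = dot (z - p) (z - p) + dot p p.
  by rewrite -[in LHS](subrK p z) (hnormDd dp).
rewrite ler_wpDl ?dnorm_ge0 // /p dnorm_sum => [|i j ij]; last first.
  by rewrite dotZl dotZr yo // !mulr0.
apply: ler_sum => i _; rewrite dnormZ /c normrM exprMn normfV.
have [->|yi] := eqVneq (y i) 0; first by rewrite !dot0r invr0 !mulr0.
rewrite (ger0_norm (dnorm_ge0 _ _)) exprVn expr2 invfM -!mulrA mulVf ?mulr1 //.
by rewrite dnorm_eq0.
Qed.

(** * Orthonormal families, Gram-Schmidt and dilation of a contraction *)

Definition orthonormal_upto m (e : nat -> U) :=
  forall i j, (i < m)%N -> (j < m)%N -> dot (e i) (e j) = (i == j)%:R.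

Definition expansion m (e : nat -> U) z := \sum_(k < m) dot z (e k) *: e k.

Lemma dot_comb m e (c : 'I_m -> C) (j : 'I_m) : orthonormal_upto m e ->
  dot (\sum_k c k *: e k) (e j) = c j.
Proof.
move=> eo; rewrite dot_suml (bigD1 j) //= big1 => [|k kj].
  by rewrite dotZl eo // eqxx mulr1 addr0.
by rewrite dotZl eo // (negbTE kj : (k == j :> nat) = false) mulr0.
Qed.

Lemma dot_comb2 m e (c d : 'I_m -> C) : orthonormal_upto m e ->
  dot (\sum_k c k *: e k) (\sum_k d k *: e k) = \sum_k c k * (d k)^*.
Proof.
move=> eo; rewrite dot_sumr; apply: eq_bigr => k _.
by rewrite dotZr dot_comb // mulrC.
Qed.

(** One Gram-Schmidt step: the nonzero residual of [x] is normalized and becomes the vector of index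
    [m]. Families are indexed by all of [nat], so extending one only overwrites a value beyond its
    orthonormal range. *)
Lemma orthonormal_step m e x : orthonormal_upto m e -> expansion m e x <> x ->
  exists e', [/\ orthonormal_upto m.+1 e', forall k, (k < m)%N -> e' k = e k
    & x = expansion m.+1 e' x].
Proof.
move=> eo xe; pose r := x - expansion m e x.
have r0 : r != 0 by rewrite subr_eq0; apply/eqP => /esym.
have re j : (j < m)%N -> dot r (e j) = 0.
  by move=> jm; rewrite /r dotBl (dot_comb _ (Ordinal jm)) // subrr.
pose s := sqrtC (dot r r); have s_gt0 : 0 < s by rewrite sqrtC_gt0 dnorm_gt0.
pose u := s^-1 *: r.
have ue j : (j < m)%N -> dot u (e j) = 0.
  by move=> jm; rewrite dotZl re ?mulr0.
have rr : dot r r = s ^+ 2 by rewrite sqrtCK.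
have sV : (s^-1)^* = s^-1 by rewrite (CrealP _) // ger0_real // invr_ge0 ltW.
have uu : dot u u = 1.
  rewrite dotZl dotZr rr sV expr2 mulKf ?gt_eqF // mulVf //.
  by rewrite gt_eqF.
exists (fun k => if k == m then u else e k); split=> [i j|k km|].
- rewrite !ltnS (leq_eqVlt i) (leq_eqVlt j).
  case: (eqVneq i m) => [->|im] /=; case: (eqVneq j m) => [->|jm] //=.
  + by move=> _ jlt; rewrite ue.
  + by move=> ilt _; rewrite dotC ue // conjC0 (negbTE im).
  + exact: eo.
- by rewrite ltn_eqF.
rewrite /expansion big_ord_recr /= eqxx.
under eq_bigr => k _ do rewrite ltn_eqF //.
(* Only the residual contributes to this coefficient, because [expansion m e x] is orthogonal to
   [u]. *)
have -> : dot x u = s.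
  rewrite -(subrK (expansion m e x) x) -/r dotDl dotZr rr sV.
  rewrite expr2 mulKf ?gt_eqF // dotZr.
  rewrite dotC dot_sumr big1 ?conjC0 ?mulr0 ?addr0 // => k _.
  by rewrite dotZr re ?mulr0.
by rewrite scalerA mulfV ?gt_eqF // scale1r addrC subrK.
Qed.

(** The coefficients of index at least [m] vanish, since [x] already lies in the span of the first
    [m] vectors. *)
Lemma expansion_extend m m' e e' x : (m <= m')%N -> orthonormal_upto m' e' ->
  (forall k, (k < m)%N -> e' k = e k) ->
  x = expansion m e x -> x = expansion m' e' x.
Proof.
move=> mm' eo' ee' xe; rewrite {1}xe /expansion.
rewrite (big_ord_widen m' (fun k => dot x (e k) *: e k)) // big_mkcond /=.
apply: eq_bigr => k _; case: ifPn => [km|]; first by rewrite ee'.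
rewrite -leqNgt => mk; rewrite xe dot_suml big1 ?scale0r // => j _.
rewrite dotZl -ee' // eo' ?(leq_trans (ltn_ord j)) // ltn_eqF ?mulr0 //.
exact: leq_trans mk.
Qed.

Lemma gram_schmidt (s : seq U) : exists m e,
  orthonormal_upto m e /\ {in s, forall x, x = expansion m e x}.
Proof.
elim: s => [|x s [m [e [eo es]]]]; first by exists 0%N, (fun=> 0); split.
have [xe|/eqP xe] := eqVneq (expansion m e x) x.
  by exists m, e; split=> // z; rewrite inE => /predU1P[->|/es].
have [e' [eo' ee' xe']] := orthonormal_step eo xe.
exists m.+1, e'; split=> // z; rewrite inE => /predU1P[->//|/es].
exact: expansion_extend.
Qed.

(** The first hypothesis is the form in which infinite dimension enters: no finite orthonormal
    family spans, so a Gram-Schmidt step is always possible. *)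
Lemma orthonormal_extension m n e :
  (forall m e, orthonormal_upto m e -> exists x, expansion m e x <> x) ->
  orthonormal_upto m e -> exists e', orthonormal_upto (m + n) e' /\
    forall k, (k < m)%N -> e' k = e k.
Proof.
move=> inf eo; elim: n => [|n [f [fo fe]]]; first by exists e; rewrite addn0.
have [x xf] := inf _ _ fo.
have [g [go gf _]] := orthonormal_step fo xf.
exists g; split=> [|k km]; first by rewrite addnS.
by rewrite gf ?fe // (leq_trans km) ?leq_addr.
Qed.

(** The block [A] uses [n] new directions, orthogonal to the span of [e]. It makes the [w i]
    orthonormal without changing their products with vectors of that span. *)
Lemma contraction_dilation m n e (L : 'M[C]_(n, m)) :
  (forall m e, orthonormal_upto m e -> exists x, expansion m e x <> x) ->
  orthonormal_upto m e ->
  (forall y : 'cV[C]_m,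
     \sum_i `|(L *m y) i 0| ^+ 2 <= \sum_k `|y k 0| ^+ 2) ->
  exists w : 'I_n -> U, (forall i j, dot (w i) (w j) = (i == j)%:R) /\
    forall i z, z = expansion m e z ->
      dot z (w i) = \sum_k L i k * dot z (e k).
Proof.
move=> inf eo /contraction_complement[A LA].
have [f [fo fe]] := orthonormal_extension n inf eo.
pose M := row_mx L A.
have MM : M *m M^t* = 1%:M by rewrite tr_row_mx map_col_mx mul_row_col.
(* The coordinates are conjugated because [dot] is conjugate-linear in its second variable; this
   also swaps the indices in the Gram matrix below. *)
exists (fun i => \sum_k (M i k)^* *: f k); split=> [i j|i z ze].
  have <- : (M *m M^t*) j i = (i == j)%:R by rewrite MM mxE eq_sym.
  rewrite dot_comb2 // mxE; apply: eq_bigr => k _.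
  by rewrite conjCK !mxE mulrC.
rewrite dot_sumr big_split_ord /= [X in _ + X]big1 ?addr0 => [|k _].
  by apply: eq_bigr => k _; rewrite dotZr conjCK fe // row_mxEl.
rewrite dotZr ze dot_suml big1 ?mulr0 // => j _.
rewrite dotZl -fe // fo ?(leq_trans (ltn_ord j)) ?leq_addr ?ltn_add2l //.
by rewrite ltn_eqF ?mulr0 // (leq_trans (ltn_ord j)) ?leq_addr.
Qed.

End DotProduct.

End InnerProductSpaces.

Lemma rnormE (R : realType) (V : normedZmodType R[i]) (x : V) :
  (rnorm x)%:C = `|x|.
Proof. by rewrite /rnorm RRe_real // ger0_real. Qed.

Lemma rnorm_ge0 (R : realType) (V : normedZmodType R[i]) (x : V) :
  0 <= rnorm x.
Proof. by rewrite -ler0c rnormE. Qed.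

Lemma sum_rnorm (R : realType) (I : finType) (V : normedZmodType R[i])
  (F : I -> V) : (\sum_i rnorm (F i) ^+ 2)%:C = \sum_i `|F i| ^+ 2.
Proof.
by rewrite rmorph_sum; apply: eq_bigr => i _; rewrite rmorphXn /= rnormE.
Qed.

(** * Functionals and orthogonal decompositions of a Hilbert space *)

Section HilbertSpace.
Variables (R : realType) (H : completeNormedModType R[i]).
Variables (dot : {dot H for Num.conj}) (hdot : is_hilbert_inner dot).

(** Cauchy-Schwarz is Bessel's inequality for a family with one vector. *)
Lemma dot_ler_norm z u : `|dot z u| <= `|z| * `|u|.
Proof.
have [->|u0] := eqVneq u 0; first by rewrite dot0r !normr0 mulr0.
have := @bessel _ _ dot 'I_1 (fun=> u) z.
rewrite big_ord1 -!hdot => /(_ _); rewrite ler_pdivrMr ?exprn_gt0 ?normr_gt0 //.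
rewrite -exprMn ler_pXn2r ?nnegrE ?mulr_ge0 //; apply => i j.
by rewrite !ord1.
Qed.

Section DotDual.
Variable u : H.

Definition dot_fun (z : H) : R[i]^o := dot z u.

Lemma dot_fun_linear : linear dot_fun.
Proof. by move=> a x y; rewrite /dot_fun dotDl dotZl. Qed.

HB.instance Definition _ :=
  GRing.isLinear.Build R[i] H R[i]^o _ dot_fun dot_fun_linear.

Lemma dot_fun_continuous : continuous dot_fun.
Proof.
apply/linear_bounded_continuous/linear_boundedP.
near=> r => z; rewrite /dot_fun (le_trans (dot_ler_norm z u)) // mulrC.
by rewrite ler_wpM2r.
Unshelve. all: by end_near. Qed.

Definition dot_dual : dual H := Dual dot_fun_continuous.

End DotDual.

Lemma infinite_dimensional_expansion : ~ finite_dimensional H ->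
  forall m e, orthonormal_upto dot m e -> exists x, expansion dot m e x <> x.
Proof.
move=> hinf m e _; apply: contrapT => /forallNP xe; apply: hinf.
exists m, (fun k => e k) => x; exists (fun k => dot x (e k)).
by have /contrapT := xe x.
Qed.

(** The range of an idempotent is its set of fixed points. Described this way, it is closed as the
    zero set of the continuous map [P i - id]. *)
Lemma orthogonal_decomposition_of_projections n (P : 'I_n -> H -> H) :
  (forall i, continuous (P i)) -> (forall i, linear (P i)) ->
  (forall i x y, dot (P i x) y = dot x (P i y)) ->
  (forall i j x, P i (P j x) = if i == j then P i x else 0) ->
  (forall x, \sum_i P i x = x) ->
  orthogonal_decomposition dot (fun i => [set x | P i x = x]%classic) /\
  forall i, is_orthogonal_projection dot [set x | P i x = x]%classic (P i).
Proof.
move=> Pcont Plin Psa PP Psum.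
have P0 i : P i 0 = 0.
  by have := Plin i (-1) 0 0; rewrite scaler0 addr0 scaleN1r addNr.
have PD i x y : P i (x + y) = P i x + P i y.
  by have := Plin i 1 x y; rewrite !scale1r.
split; last first.
  move=> i x; split=> [|y /= <-]; first by rewrite /= PP eqxx.
  rewrite -Psa -[x - _]addrC -scaleN1r Plin scaleN1r PP eqxx addNr.
  exact: dot0l.
split=> [i|i j ij x y /= <- <-|x].
- split.
    split=> [|a x y]; rewrite !inE /= ?P0 // => Px Py.
    by rewrite Plin Px Py.
  have -> : [set x | P i x = x]%classic
      = ((fun x => P i x - x) @^-1` [set 0])%classic.
    apply/seteqP; split=> x /= => [->|/eqP].
      by rewrite subrr.
    by rewrite subr_eq0 => /eqP.
  apply: preimage_closed => [x _|].
    by apply: continuousB; [exact: Pcont|exact: cvg_id].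
  apply: (accessible_finite_set_closed.1 _ _ (finite_set1 _)).
  exact: hausdorff_accessible (@norm_hausdorff _ _).
- by rewrite Psa PP (negbTE ij) dot0r.
exists (fun i => P i x); split=> [|y [yP xy]].
  by split=> [i|]; rewrite ?Psum //= PP eqxx.
(* Uniqueness: applying [P i] to the sum of the [y j] kills every term but [y i]. *)
apply/funext => i; rewrite xy.
have -> : P i (\sum_j y j) = \sum_j P i (y j).
  by apply: (big_morph (P i) (PD i) (P0 i)).
rewrite (bigD1 i) //= yP big1 ?addr0 // => j ji.
by rewrite -yP PP eq_sym (negbTE ji).
Qed.

(** The last conjunct serves to evaluate the product of a sum of projections [P i (x i)] with [w j]:
    only [dot (x j) (w j)] survives. *)
Lemma orthonormal_decomposition n (w : 'I_n -> H) (i0 : 'I_n) :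
  (forall i j, dot (w i) (w j) = (i == j)%:R) ->
  exists (Hs : 'I_n -> set H) (P : 'I_n -> H -> H),
    [/\ orthogonal_decomposition dot Hs,
        forall i, is_orthogonal_projection dot (Hs i) (P i)
      & forall i j z, dot (P i z) (w j) = if i == j then dot z (w i) else 0].
Proof.
move=> wo; pose Q i z := dot z (w i) *: w i; pose E z := z - \sum_j Q j z.
(* Everything orthogonal to the w j is put into the summand i0. *)
pose P i z := Q i z + (if i == i0 then E z else 0).
have Qlin i : linear (Q i).
  by move=> a x y; rewrite /Q dotDl dotZl scalerDl scalerA.
have Elin : linear E.
  move=> a x y; rewrite /E; under eq_bigr do rewrite Qlin.
  by rewrite big_split /= -scaler_sumr opprD addrACA scalerBr.
have Ew z i : dot (E z) (w i) = 0.
  rewrite /E dotBl dot_suml (bigD1 i) //= big1 ?addr0 => [|j ji].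
    by rewrite dotZl wo eqxx mulr1 subrr.
  by rewrite dotZl wo (negbTE ji) mulr0.
have QQ i j z : Q i (Q j z) = if i == j then Q i z else 0.
  rewrite /Q dotZl wo eq_sym; case: eqP => [->|_]; first by rewrite mulr1.
  by rewrite mulr0 scale0r.
have QE i z : Q i (E z) = 0 by rewrite /Q Ew scale0r.
have EQ j z : E (Q j z) = 0.
  rewrite /E (bigD1 j) //= big1 => [|i ij].
    by rewrite QQ eqxx addr0 subrr.
  by rewrite QQ (negbTE ij).
have EE z : E (E z) = E z.
  by rewrite {1}/E big1 ?subr0 // => j _; rewrite QE.
have Plin i : linear (P i).
  move=> a x y; rewrite /P Qlin; case: ifP => _; last by rewrite !addr0.
  by rewrite Elin addrACA -scalerDr.
have Qcont i : continuous (Q i).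
  move=> z; apply: cvgZl; exact: dot_fun_continuous.
have Econt : continuous E.
  move=> z; apply: cvgB; first exact: cvg_id.
  by apply: cvg_big => [|j _]; [exact: add_continuous|exact: Qcont].
have [] := @orthogonal_decomposition_of_projections n P.
- move=> i z; rewrite /P; case: (i == i0); last first.
    by apply: cvgD; [exact: Qcont|exact: cvg_cst].
  by apply: cvgD; [exact: Qcont|exact: Econt].
- exact: Plin.
- have Qsa i x y : dot (Q i x) y = dot x (Q i y).
    by rewrite /Q dotZl dotZr -dotC mulrC.
  move=> i x y; rewrite /P dotDl dotDr Qsa; congr (_ + _).
  case: ifP => _; last by rewrite dot0l dot0r.
  rewrite /E dotBl dotBr dot_suml dot_sumr; congr (_ - _).
  by apply: eq_bigr => j _; rewrite Qsa.
- have linD (f : H -> H) : linear f -> forall x y, f (x + y) = f x + f y.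
    by move=> flin a c; have := flin 1 a c; rewrite !scale1r.
  have Q0 i : Q i 0 = 0 by rewrite /Q dot0l scale0r.
  have E0 : E 0 = 0 by rewrite /E big1 ?subr0.
  move=> i j z; rewrite /P (linD _ (Qlin i)) (linD _ Elin) EQ add0r QQ.
  have -> : Q i (if j == i0 then E z else 0) = 0 by case: ifP.
  rewrite addr0; have [->|ij] := eqVneq i j.
    by case: (j == i0); rewrite ?EE.
  rewrite add0r; case: ifP => // /eqP ii0.
  by rewrite -ii0 eq_sym (negbTE ij) E0.
- move=> z; rewrite /P big_split /= -big_mkcond /= big_pred1_eq.
  by rewrite /E addrC subrK.
move=> dec proj; exists (fun i => [set x | P i x = x]%classic), P; split=> //.
move=> i j z; rewrite /P dotDl dotZl wo.
have -> : dot (if i == i0 then E z else 0) (w j) = 0.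
  by case: ifP => _; rewrite ?Ew ?dot0l.
by case: eqP => [->|_]; rewrite ?mulr1 ?mulr0 addr0.
Qed.

(** * The two inequalities between the multi-norms *)

Lemma hilbert_multinorm_le n (x : 'I_n -> H) :
  (hilbert_multinorm dot x <= multinorm22 x)%E.
Proof.
apply: ge_ereal_sup => r [Hs [P [[_ Horth _] Pproj ->]]].
(* If [y i = 0] then [u i = 0], since the inverse of 0 is 0; this agrees with the zero quotient in
   [bessel], so [uE] needs no case split. *)
pose y i := P i (x i); pose u i := `|y i|^-1 *: y i.
have yo i j : i != j -> dot (y i) (y j) = 0.
  move=> ij; apply: (Horth _ _ ij).
    by case: (Pproj i (x i)).
  by case: (Pproj j (x j)).
have uE z i : `|dot z (u i)| ^+ 2 = `|dot z (y i)| ^+ 2 / dot (y i) (y i).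
  by rewrite dotZr normrM norm_conjC normfV normr_id exprMn exprVn hdot mulrC.
apply: ereal_sup_ubound; exists (fun i => dot_dual (u i)) => /=.
  apply: ge_ereal_sup => _ [z /= z1 <-].
  rewrite lee_fin -[leRHS]sqrtr1 ler_wsqrtr // -lecR sum_rnorm.
  under eq_bigr => i _ do rewrite uE.
  apply: (le_trans (bessel z yo)); rewrite -hdot -rnormE -rmorphXn /= lecR.
  by rewrite exprn_ile1 // rnorm_ge0.
congr _%:E; rewrite -[RHS]ger0_norm ?rnorm_ge0 // -sqrtr_sqr; congr Num.sqrt.
apply: complexI; rewrite sum_rnorm rmorphXn /= rnormE hdot (dnorm_sum yo).
apply: eq_bigr => i _; rewrite [LHS]uE.
(* [x i - y i] is orthogonal to the summand that contains [y i]. *)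
have -> : dot (x i) (y i) = dot (y i) (y i).
  have [yS yP] := Pproj i (x i).
  by apply/eqP; rewrite -subr_eq0 -dotBl yP.
have [->|yi] := eqVneq (y i) 0; first by rewrite !dot0r invr0 mulr0.
by rewrite ger0_norm ?dnorm_ge0 // expr2 mulfK // dnorm_eq0.
Qed.

(** Homogeneity carries the bound from the unit ball to all vectors, by normalizing [z]. *)
Lemma weak_2_summing_contraction n (lam : 'I_n -> dual H) z :
  (weak_2_summing_norm lam <= 1)%E -> \sum_i `|lam i z| ^+ 2 <= `|z| ^+ 2.
Proof.
move=> lam1; have [->|z0] := eqVneq z 0.
  by rewrite big1 ?normr0 ?expr0n //= => i _; rewrite linear0 normr0 expr0n.
pose z' := `|z|^-1 *: z.
have z'1 : rnorm z' <= 1.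
  by rewrite -lecR rnormE normrZ normfV normr_id mulVf ?normr_eq0.
have : ((Num.sqrt (\sum_j rnorm (lam j z') ^+ 2))%:E <= 1)%E.
  by apply: le_trans lam1; apply: ereal_sup_ubound; exists z'.
rewrite lee_fin -[leRHS]sqrtr1 ler_sqrt // -lecR sum_rnorm.
have -> : \sum_i `|lam i z'| ^+ 2 = (\sum_i `|lam i z| ^+ 2) / `|z| ^+ 2.
  rewrite mulr_suml; apply: eq_bigr => i _.
  by rewrite linearZ normrM normfV normr_id exprMn exprVn mulrC.
by rewrite ler_pdivrMr ?mul1r // exprn_gt0 ?normr_gt0.
Qed.

Lemma multinorm22_le n (x : 'I_n -> H) : ~ finite_dimensional H -> (0 < n)%N ->
  (multinorm22 x <= hilbert_multinorm dot x)%E.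
Proof.
move=> hinf hn; apply: ge_ereal_sup => _ [lam /= lam1 <-].
have [m [e [eo xe]]] := gram_schmidt dot (codom x).
pose L := \matrix_(i < n, k < m) (lam i (e k) : R[i]).
have Lcontr (y : 'cV_m) :
    \sum_i `|(L *m y) i 0| ^+ 2 <= \sum_k `|y k 0| ^+ 2.
  (* The column [y] holds the coordinates of [z], and [L *m y] lists the values [lam i z]; so
     contractivity of [L] is admissibility of [lam] tested on the span of [e]. *)
  pose z := \sum_(k < m) y k 0 *: e k.
  have -> : \sum_k `|y k 0| ^+ 2 = `|z| ^+ 2.
    by rewrite hdot dot_comb2 //; apply: eq_bigr => k _; rewrite normCK.
  apply: le_trans (weak_2_summing_contraction z lam1).
  apply: ler_sum => i _; rewrite mxE linear_sum le_eqVlt; apply/orP; left.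
  apply/eqP; congr (`|_| ^+ 2); apply: eq_bigr => k _.
  by rewrite mxE linearZ mulrC.
have [w [wo wL]] :=
  contraction_dilation (infinite_dimensional_expansion hinf) eo Lcontr.
have lamw i : lam i (x i) = dot (x i) (w i).
  have xie := xe _ (codom_f x i).
  rewrite (wL _ _ xie) {1}xie linear_sum; apply: eq_bigr => k _.
  by rewrite mxE linearZ mulrC.
have [Hs [P [dec proj Pw]]] := orthonormal_decomposition (Ordinal hn) wo.
pose v := \sum_i P i (x i).
apply: (@le_trans _ _ (rnorm v)%:E); last first.
  by apply: ereal_sup_ubound; exists Hs, P.
rewrite lee_fin -[leRHS]ger0_norm ?rnorm_ge0 // -sqrtr_sqr ler_wsqrtr //.
rewrite -lecR sum_rnorm rmorphXn /= rnormE hdot.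
(* Bessel's inequality for [v] and the orthonormal [w i]: the coefficient [dot v (w i)] equals
   [dot (x i) (w i)], that is [lam i (x i)]. *)
apply: le_trans (_ : \sum_i `|dot v (w i)| ^+ 2 / dot (w i) (w i) <= _).
  apply: ler_sum => i _; rewrite wo eqxx invr1 mulr1 lamw.
  rewrite /v dot_suml (bigD1 i) //= Pw eqxx big1 ?addr0 // => j ji.
  by rewrite Pw (negbTE ji).
by apply: bessel => i j ij; rewrite wo (negbTE ij).
Qed.

End HilbertSpace.

Theorem theorem4p19 (R : realType) (H : completeNormedModType R[i])
    (dot : {dot H for Num.conj}) (hdot : is_hilbert_inner dot)
    (hinf : ~ finite_dimensional H)
    (n : nat) (hn : (0 < n)%N) (x : 'I_n -> H) :
  hilbert_multinorm dot x = multinorm22 x.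
Proof.
by apply/eqP; rewrite eq_le hilbert_multinorm_le // multinorm22_le.
Qed.
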